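(* For every $\alpha\in[0,1)$, $\mathrm{DIM}^\alpha_{\mathrm{str}}=\{A\in\mathbf C:{\mathrm{Dim}}(A)=\alpha\}$ is Wadge complete for $\boldsymbol\Pi^0_3$. Therefore $\mathrm{DIM}^\alpha_{\mathrm{str}}$ is not a $\boldsymbol\Sigma^0_3$-class, and in particular it is not a $\Sigma^0_3[\Pi^0_1]$-class.
   Context: $\mathbf{C}=\{0,1\}^{\mathbb N}$; $A\upharpoonright n$ is the first $n$ bits of $A$. ${\mathrm{Dim}}(A)$ is the constructive strong dimension: the infimum of $s$ such that some lower semicomputable $s$-gale $d$ (i.e. $d:\{0,1\}^*\to[0,\infty)$ with $2^sd(w)=d(w0)+d(w1)$) satisfies $\liminf_n d(A\upharpoonright n)=\infty$; equivalently ${\mathrm{Dim}}(A)=\limsup_n K(A\upharpoonright n)/n$, $K$ prefix-free Kolmogorov complexity. A Wadge reduction of $\mathcal A$ to $\mathcal B$ is a continuous $f:\mathbf C\to\mathbf C$ with $X\in\mathcal A\iff f(X)\in\mathcal B$; $\mathcal B$ is Wadge complete for $\boldsymbol\Gamma$ if $\mathcal B\in\boldsymbol\Gamma$ and every $\mathcal A\in\boldsymbol\Gamma$ Wadge reduces to $\mathcal B$. $\boldsymbol\Sigma^0_n,\boldsymbol\Pi^0_n$: Borel hierarchy. $\mathcal X\in\Sigma^0_3[\Pi^0_1]$ means: for some co-c.e. predicate $P$, $A\in\mathcal X\iff(\exists k_3)(\forall k_2)(\exists k_1)P(k_3,k_2,A\upharpoonright k_1)$. *)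

(* Defs.v *)
From Stdlib Require Cantor.
From mathcomp Require Import all_boot all_order all_algebra.
From mathcomp Require Import all_classical all_reals all_analysis.

Set Implicit Arguments.
Unset Strict Implicit.
Unset Printing Implicit Defensive.

Import Order.TTheory GRing.Theory Num.Theory.
Import numFieldNormedType.Exports.

Local Open Scope classical_set_scope.
Local Open Scope ring_scope.

Definition npair (x y : nat) : nat := Cantor.to_nat (x, y).
Definition nfst (n : nat) : nat := (Cantor.of_nat n).1.
Definition nsnd (n : nat) : nat := (Cantor.of_nat n).2.

(** Partial recursive functions, presented with unary functions and the Cantor
    pairing instead of arities: with [<x, y> := npair x y],
    - [Prec f g] maps [<a, 0>] to [f a] and [<a, n + 1>] to
      [g <a, <n, Prec f g <a, n>>>];
    - [Mu f] maps [a] to the least [n] such that [f <a, n> = 0], where all the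
      [f <a, m>] for [m < n] are required to be defined. *)
Inductive code : Type :=
| Zero | Succ | Fst | Snd
| Pair of code & code
| Comp of code & code
| Prec of code & code
| Mu of code.

(** [eval c x y] means that the computation of [c] on [x] halts with output
    [y]. *)
Fixpoint eval (c : code) (x y : nat) {struct c} : Prop :=
  match c with
  | Zero => y = 0%N
  | Succ => y = x.+1
  | Fst => y = nfst x
  | Snd => y = nsnd x
  | Pair f g => exists u v, [/\ eval f x u, eval g x v & y = npair u v]
  | Comp f g => exists2 z, eval g x z & eval f z y
  | Prec f g =>
      (fix rec (n y : nat) {struct n} : Prop :=
         match n with
         | 0%N => eval f (nfst x) y
         | m.+1 =>
             exists2 z, rec m z & eval g (npair (nfst x) (npair m z)) y
         end) (nsnd x) y
  | Mu f =>
      eval f (npair x y) 0%N /\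
      (forall m, (m < y)%N -> exists k, eval f (npair x m) k.+1)
  end.

Definition computable (f : nat -> nat) : Prop :=
  exists c, forall n, eval c n (f n).

Definition ce (P : set nat) : Prop :=
  exists c, forall n, P n <-> exists y, eval c n y.

(** Bijective base-2 numeration, a bijection between [seq bool] and [nat]. *)
Definition str_code (w : seq bool) : nat :=
  foldr (fun (b : bool) n => (n.*2 + b).+1) 0%N w.

(** [P] is decoded from the triples [<k3, <k2, w>>], which exhaust [nat]. *)
Definition co_ce (P : nat -> nat -> seq bool -> Prop) : Prop :=
  ce [set n | exists k3 k2 w,
        n = npair k3 (npair k2 (str_code w)) /\ ~ P k3 k2 w].

Definition first_bits (A : cantor_space) (n : nat) : seq bool :=
  mkseq (fun i => A i) n.

Section Dimension.
Variable R : realType.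

Definition gale (s : R) (d : seq bool -> R) : Prop :=
  (forall w, 0 <= d w) /\
  (forall w, 2 `^ s * d w = d (rcons w false) + d (rcons w true)).

(** [d] is the pointwise limit of a computable nondecreasing sequence of
    functions from strings to nonnegative rationals, given by numerators [p]
    and denominators [q + 1]. *)
Definition lower_semicomputable (d : seq bool -> R) : Prop :=
  exists p q : nat -> nat,
    [/\ computable p, computable q &
        forall w,
          let dw t := (p (npair (str_code w) t))%:R
                      / (q (npair (str_code w) t)).+1%:R : R in
          nondecreasing_seq dw /\ dw t @[t --> \oo] --> d w].

Definition succeeds_strongly (d : seq bool -> R) (A : cantor_space) : Prop :=
  limn_einf (fun n => (d (first_bits A n))%:E) = +oo%E.

(** The set is nonempty, as it contains every [s > 1] with [2 `^ s] rational,
    so [inf] is the genuine infimum. *)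
Definition Dim (A : cantor_space) : R :=
  inf [set s : R | 0 <= s /\
        exists d, [/\ gale s d, lower_semicomputable d
                    & succeeds_strongly d A]].

Definition DIM_str (alpha : R) : set cantor_space :=
  [set A | Dim A = alpha].

End Dimension.

(** [Sigma0 n] is the boldface class; the hierarchy starts at level 1, and
    level 0 is an empty class. *)
Fixpoint Sigma0 (T : topologicalType) (n : nat) (A : set T) : Prop :=
  match n with
  | 0%N => False
  | m.+1 =>
      if m is 0%N then open A
      else exists2 F : nat -> set T,
             (forall i, Sigma0 m (~` F i)) & A = \bigcup_i F i
  end.

Definition Pi0 (T : topologicalType) (n : nat) (A : set T) : Prop :=
  Sigma0 n (~` A).

Definition wadge_reduction (A B : set cantor_space)
    (f : cantor_space -> cantor_space) : Prop :=
  continuous f /\ (forall X, A X <-> B (f X)).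

Definition wadge_complete (Gamma : set cantor_space -> Prop)
    (B : set cantor_space) : Prop :=
  Gamma B /\ (forall A, Gamma A -> exists f, wadge_reduction A B f).

Definition Sigma03_Pi01 (X : set cantor_space) : Prop :=
  exists2 P : nat -> nat -> seq bool -> Prop, co_ce P &
    forall A, X A <->
      exists k3, forall k2, exists k1, P k3 k2 (first_bits A k1).

(* Main.v *)
(** The strong dimension of [A] is less than [q] iff, for some [s] with
    [0 <= s < q], some lower semicomputable [s]-gale eventually exceeds 1 along
    [A]: multiplying by [(1 + 1/k)^n] then turns "eventually exceeds 1" into
    strong success at a slightly larger exponent. As there are only countably
    many such gales, [[set A | Dim A < q]] is a countable union of closed sets,
    so [DIM_str alpha] is Pi^0_3.

    For hardness, a Pi^0_3 set is the set of [X] for which a sequence of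
    labels, computed continuously from [X], tends to infinity. A sequence of
    labels is sent to a point whose bits are 0 outside a set of free positions
    of density [alpha + (1 - alpha) / (label + 1)], the label being constant on
    each of very long blocks, while the free bits are chosen against finitely
    many lower semicomputable gales at a time. A gale that bets on 0 at the
    positions that are not free shows that the strong dimension is at most the
    limsup of the densities; the choice of the free bits shows that it is at
    least that. *)

From mathcomp Require Import all_boot all_order all_algebra.
From mathcomp Require Import all_classical all_reals all_analysis.
From mathcomp Require Import zify ring lra.
Require Import Defs.

Set Implicit Arguments.
Unset Strict Implicit.
Unset Printing Implicit Defensive.

Import Order.TTheory GRing.Theory Num.Theory.
Import numFieldNormedType.Exports.

Local Open Scope classical_set_scope.
Local Open Scope ring_scope.

(** * Computable functions *)

Lemma nfst_npair x y : nfst (npair x y) = x.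
Proof. by rewrite /nfst /npair Cantor.cancel_of_to. Qed.

Lemma nsnd_npair x y : nsnd (npair x y) = y.
Proof. by rewrite /nsnd /npair Cantor.cancel_of_to. Qed.

Lemma npairK n : npair (nfst n) (nsnd n) = n.
Proof.
by rewrite /nfst /nsnd /npair -surjective_pairing Cantor.cancel_to_of.
Qed.

Lemma eval_det c x y z : eval c x y -> eval c x z -> y = z.
Proof.
elim: c x y z => [||||f IHf g IHg|f IHf g IHg|f IHf g IHg|f IHf] x y z /=.
- by move=> -> ->.
- by move=> -> ->.
- by move=> -> ->.
- by move=> -> ->.
- move=> [u [v [fu gv ->]]] [u' [v' [fu' gv' ->]]].
  by rewrite (IHf _ _ _ fu fu') (IHg _ _ _ gv gv').
- move=> [u gu fu] [v gv fv]; apply: (IHf _ _ _ fu).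
  by rewrite (IHg _ _ _ gu gv).
- elim: (nsnd x) y z => [|n IHn] y z; first exact: IHf.
  move=> [u ru gu] [v rv gv]; apply: (IHg _ _ _ gu).
  by rewrite (IHn _ _ ru rv).
- move=> [fy ly] [fz lz]; apply/eqP; rewrite eqn_leq; apply/andP; split.
    rewrite leqNgt; apply/negP => /ly[k fk]; have := IHf _ _ _ fz fk.
    by [].
  rewrite leqNgt; apply/negP => /lz[k fk]; have := IHf _ _ _ fy fk.
  by [].
Qed.

Lemma computable_comp f g : computable f -> computable g ->
  computable (fun n => f (g n)).
Proof. by move=> [c cf] [d dg]; exists (Comp c d) => n /=; exists (g n). Qed.

Lemma computable_pair f g : computable f -> computable g ->
  computable (fun n => npair (f n) (g n)).
Proof. by move=> [c cf] [d dg]; exists (Pair c d) => n /=; exists (f n), (g n). Qed.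

Lemma computable_nfst f : computable f -> computable (fun n => nfst (f n)).
Proof. by move=> cf; apply: computable_comp cf; exists Fst. Qed.

Lemma computable_nsnd f : computable f -> computable (fun n => nsnd (f n)).
Proof. by move=> cf; apply: computable_comp cf; exists Snd. Qed.

Lemma computable_succ f : computable f -> computable (fun n => (f n).+1).
Proof. by move=> cf; apply: (@computable_comp succn) cf; exists Succ. Qed.

Lemma computable_id : computable id.
Proof.
exists (Pair Fst Snd) => n /=; exists (nfst n), (nsnd n).
by rewrite npairK.
Qed.

Lemma computable_const k : computable (fun=> k).
Proof.
elim: k => [|k IHk]; first by exists Zero.
exact: computable_succ IHk.
Qed.

(** [Prec] hands its step the input, the counter and the previous value; the counter is dropped
    here. The arithmetic below reduces to such iterations. *)
Lemma computable_iter n f g : computable n -> computable f -> computable g ->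
  computable (fun x => iter (n x) (fun z => g (npair x z)) (f x)).
Proof.
move=> [cn hn] [cf hf] [cg hg].
exists (Comp (Prec cf (Comp cg (Pair Fst (Comp Snd Snd))))
             (Pair (Pair Fst Snd) cn)) => x.
exists (npair x (n x)).
  exists x, (n x); split=> //.
  by exists (nfst x), (nsnd x); rewrite npairK.
rewrite /= nsnd_npair nfst_npair.
elim: (n x) => [|m IHm] //=.
exists (iter m (fun z => g (npair x z)) (f x)) => //.
set z := iter _ _ _; exists (npair x z) => //.
exists x, z; split=> //; first by rewrite nfst_npair.
by exists (npair m z); rewrite nsnd_npair.
Qed.

Lemma computable_addn f g : computable f -> computable g ->
  computable (fun n => (f n + g n)%N).
Proof.
move=> cf cg; have := computable_iter cg cf
  (computable_succ (computable_nsnd computable_id)).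
congr computable; apply/funext => x.
by elim: (g x) => [|m IHm]; rewrite ?addn0//= IHm nsnd_npair addnS.
Qed.

Lemma computable_muln f g : computable f -> computable g ->
  computable (fun n => (f n * g n)%N).
Proof.
move=> cf cg.
have := computable_iter cf (computable_const 0)
  (computable_addn (computable_comp cg (computable_nfst computable_id))
                   (computable_nsnd computable_id)).
congr computable; apply/funext => x.
elim: (f x) => [|m IHm]; rewrite ?mul0n//= IHm nfst_npair nsnd_npair.
by rewrite mulSn.
Qed.

Lemma computable_expn k g : computable g -> computable (fun n => (k ^ g n)%N).
Proof.
move=> cg.
have := computable_iter cg (computable_const 1)
  (computable_muln (computable_const k) (computable_nsnd computable_id)).
congr computable; apply/funext => x.
by elim: (g x) => [|m IHm]; rewrite ?expn0//= IHm nsnd_npair expnS.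
Qed.

Lemma computable_pred f : computable f -> computable (fun n => (f n).-1).
Proof.
move=> cf.
have cs := computable_nsnd (computable_nsnd computable_id).
(* The iterated map sends [(a, b)] to [(b, b + 1)], so that the first component lags one step
   behind. *)
have := computable_nfst (computable_iter cf
  (computable_pair (computable_const 0) (computable_const 0))
  (computable_pair cs (computable_succ cs))).
congr computable; apply/funext => x.
set h := fun z => _.
suff -> : iter (f x) h (npair 0 0) = npair (f x).-1 (f x) by rewrite nfst_npair.
by elim: (f x) => //= m ->; rewrite /h !nsnd_npair.
Qed.

Lemma computable_half f : computable f -> computable (fun n => (f n)./2).
Proof.
move=> cf; have cz := computable_nsnd computable_id.
(* Here [(a, b)] goes to [(b, a + 1)]: each component grows at every second step. *)
have := computable_nfst (computable_iter cf
  (computable_pair (computable_const 0) (computable_const 0))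
  (computable_pair (computable_nsnd cz) (computable_succ (computable_nfst cz)))).
congr computable; apply/funext => x.
set h := fun z => _.
suff -> : iter (f x) h (npair 0 0) = npair (f x)./2 (uphalf (f x)).
  by rewrite nfst_npair.
by elim: (f x) => //= m ->; rewrite /h !nsnd_npair nfst_npair.
Qed.

Lemma computable_subn f g : computable f -> computable g ->
  computable (fun n => (f n - g n)%N).
Proof.
move=> cf cg.
have := computable_iter cg cf (computable_pred (computable_nsnd computable_id)).
congr computable; apply/funext => x.
by elim: (g x) => [|m IHm]; rewrite ?subn0//= IHm nsnd_npair subnS.
Qed.

Lemma computable_if (b : nat -> bool) f g :
  computable (fun n => b n : nat) -> computable f -> computable g ->
  computable (fun n => if b n then f n else g n).
Proof.
move=> cb cf cg.
have := computable_iter cb cg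
  (computable_comp cf (computable_nfst computable_id)).
by congr computable; apply/funext => x; case: (b x) => //=; rewrite nfst_npair.
Qed.

Lemma computable_ltn f g : computable f -> computable g ->
  computable (fun n => (f n < g n)%N : nat).
Proof.
move=> cf cg; pose s x := (g x - f x)%N.
have cs : computable s by exact: computable_subn.
have := computable_subn cs (computable_pred cs).
by congr computable; apply/funext => x; rewrite /s; case: ltnP; lia.
Qed.

Lemma computable_odd f : computable f -> computable (fun n => odd (f n) : nat).
Proof.
move=> cf; have ch := computable_half cf.
have := computable_subn cf (computable_addn ch ch).
by congr computable; apply/funext => x; lia.
Qed.

Lemma size_str_code w : (size w <= str_code w)%N.
Proof. by elim: w => //= b w; lia. Qed.

(** Predecessor, parity and half peel the head bit off a string code. Iterating [str_code w] times
    is enough by [size_str_code], and the surplus steps do nothing because the empty string has code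
    0. *)
Lemma computable_foldl (F : nat -> bool -> nat) z0 :
  computable (fun n => F (nfst n) (odd (nsnd n))) ->
  exists2 h, computable h & forall w, h (str_code w) = foldl F z0 w.
Proof.
move=> cF.
pose t n := (nfst n).-1.
pose step n := if (0 < nfst n)%N
               then npair (t n)./2 (F (nsnd n) (odd (t n))) else n.
have ct : computable t.
  exact/computable_pred/computable_nfst/computable_id.
have cstep : computable step.
  apply: computable_if; last exact: computable_id.
    by apply: computable_ltn; [exact: computable_const|
                               exact/computable_nfst/computable_id].
  apply: computable_pair; first exact: computable_half.
  have := computable_comp cF
    (computable_pair (computable_nsnd computable_id) ct).
  congr computable; apply/funext => n; by rewrite nfst_npair nsnd_npair.
exists (fun n => nsnd (iter n step (npair n z0))).
  apply: computable_nsnd.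
  have := computable_iter computable_id
    (computable_pair computable_id (computable_const z0))
    (computable_comp cstep (computable_nsnd computable_id)).
  congr computable; apply/funext => n.
  by apply: eq_iter => z; rewrite nsnd_npair.
move=> w; rewrite -(nsnd_npair 0 (foldl F z0 w)); congr nsnd.
elim: w {1 2}(str_code w) z0 (size_str_code w) => [|b w IHw] k z0 /=.
  by move=> _; elim: k => //= k ->; rewrite /step nfst_npair.
case: k => // k lek; rewrite iterSr {2}/step nfst_npair /= /t.
rewrite !nfst_npair /= nsnd_npair.
have -> : ((str_code w).*2 + b)./2 = str_code w by lia.
have -> : odd ((str_code w).*2 + b) = b by lia.
exact: IHw.
Qed.

(** * The Borel hierarchy on the Cantor space *)

Lemma first_bitsP (X Y : cantor_space) n :
  first_bits X n = first_bits Y n <-> forall i, (i < n)%N -> X i = Y i.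
Proof.
split=> [XY i ltin|XY].
  by have := congr1 (nth false ^~ i) XY; rewrite !nth_mkseq.
by apply/eq_in_map => i; rewrite mem_iota => /XY.
Qed.

Lemma first_bits_le (X Y : cantor_space) m n : (m <= n)%N ->
  first_bits X n = first_bits Y n -> first_bits X m = first_bits Y m.
Proof.
move=> lemn /first_bitsP XY; apply/first_bitsP => i ltim.
exact/XY/(leq_trans ltim).
Qed.

Lemma first_bitsS (X : cantor_space) n :
  first_bits X n.+1 = rcons (first_bits X n) (X n).
Proof. by rewrite /first_bits -mkseqS. Qed.

Lemma size_first_bits (X : cantor_space) n : size (first_bits X n) = n.
Proof. exact: size_mkseq. Qed.

Lemma nbhs_first_bits (X : cantor_space) n :
  nbhs X [set Y | first_bits Y n = first_bits X n].
Proof.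
elim: n => [|n IHn]; first by apply: filterS filterT.
have := @proj_continuous nat (fun=> bool) n X.
move/(_ [set X n]) => /=; rewrite nbhs_simpl /= => /(_ (discrete_set1 _)) Xn.
apply: filterS (filterI IHn Xn) => Y [/= YX]; rewrite /proj /= => YXn.
by rewrite !first_bitsS YX YXn.
Qed.

Lemma nbhs_cantorP (X : cantor_space) (U : set cantor_space) :
  nbhs X U <-> exists n, forall Y, first_bits Y n = first_bits X n -> U Y.
Proof.
split=> [XU|[n nU]]; last exact: filterS (nbhs_first_bits X n).
pose F : set_system cantor_space := filter_from [set: nat]
  (fun n => [set Y | first_bits Y n = first_bits X n]).
have FF : Filter F.
  apply: filter_from_filter; first by exists 0%N.
  move=> m n _ _; exists (maxn m n) => // Y /= YX.
  by split; [apply: first_bits_le YX; rewrite leq_maxl|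
             apply: first_bits_le YX; rewrite leq_maxr].
(* The topology is the supremum of those induced by the coordinates, and coordinate [i] is decided
   by the first [i + 1] bits. *)
suff /(_ U XU)[n _ nU] : F --> X by exists n.
apply/cvg_sup => i V.
have /= -> := @nbhsE (initial_topology (fun f : nat -> bool => f i)) X.
case=> B [[C oC <- /= CX]] BV; exists i.+1 => // Y /= YX; apply: BV => /=.
by have /first_bitsP -> := YX.
Qed.

Lemma open_cantorP (U : set cantor_space) :
  open U <-> forall X, U X ->
    exists n, forall Y, first_bits Y n = first_bits X n -> U Y.
Proof.
rewrite openE; split=> [oU X /oU/nbhs_cantorP//|oU X /oU ?].
exact/nbhs_cantorP.
Qed.

Lemma open_first_bits n (U : set cantor_space) :
  (forall X Y, first_bits Y n = first_bits X n -> U X -> U Y) -> open U.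
Proof.
by move=> nU; apply/open_cantorP => X UX; exists n => Y /nU; apply.
Qed.

Lemma continuous_cantor (f : cantor_space -> cantor_space) :
  (forall n X, exists m, forall Y, first_bits Y m = first_bits X m ->
    first_bits (f Y) n = first_bits (f X) n) -> continuous f.
Proof.
move=> cf X U /nbhs_cantorP[n nU]; have [m mf] := cf n X.
by apply/nbhs_cantorP; exists m => Y /mf/nU.
Qed.

(** The points whose first [n] bits already force membership in [U] form a clopen set, and these
    sets exhaust [U]. *)
Lemma open_bigcup_closed (U : set cantor_space) : open U ->
  exists2 G : nat -> set cantor_space,
    forall j, open (~` G j) & U = \bigcup_j G j.
Proof.
move=> /open_cantorP oU.
exists (fun n => [set X | forall Y, first_bits Y n = first_bits X n -> U Y]).
  move=> n; apply: (@open_first_bits n) => X Y YX /= UX UY; apply: UX => Z ZX.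
  by apply: UY; rewrite YX.
apply/seteqP; split=> [X /oU[n nU]|X [n _]]; first by exists n.
exact.
Qed.

Lemma Pi03P (T : topologicalType) (A : set T) : Pi0 3 A <->
  exists2 G : nat -> nat -> set T,
    forall i j, open (~` G i j) & A = \bigcap_i \bigcup_j G i j.
Proof.
split=> [[F F2 AF]|[G oG ->]].
  have /choice[G GP] i : exists G : nat -> set T,
      (forall j, open (~` G j)) /\ ~` F i = \bigcup_j G j.
    by have [G oG FG] := F2 i; exists G.
  exists G => [i j|]; first by have [] := GP i.
  rewrite -[A]setCK AF setC_bigcup; apply: eq_bigcapr => i _.
  by have [] := GP i.
rewrite /Pi0; exists (fun i => ~` (\bigcup_j G i j)).
  by move=> i; exists (G i); rewrite ?setCK//; exact: oG.
by rewrite setC_bigcap.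
Qed.

Lemma Sigma0_preimage (S T : topologicalType) (f : S -> T) n (A : set T) :
  continuous f -> Sigma0 n A -> Sigma0 n (f @^-1` A).
Proof.
move=> cf; elim: n A => // -[_ A|n IHn A [F F2 ->]].
  exact: (continuousP _).1 cf A.
exists (fun i => f @^-1` F i); first by move=> i; exact: IHn (F2 i).
by rewrite preimage_bigcup.
Qed.

Lemma str_code_inj : injective str_code.
Proof.
elim=> [|b w IHw] [|c v] //= [] bc.
have [-> /IHw ->] : b = c /\ str_code w = str_code v by lia.
by [].
Qed.

(* Every [Z] codes the open set of all points with a prefix in [Z]; this
   diagonalizes against the universal Sigma^0_3 set obtained from the columns
   of [X]. *)
Lemma exists_Pi03_not_Sigma03 :
  exists2 D : set cantor_space, Pi0 3 D & ~ Sigma0 3 D.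
Proof.
pose O i j (X Y : cantor_space) :=
  exists n, X (npair i (npair j (str_code (first_bits Y n)))).
pose D : set cantor_space := \bigcap_i \bigcup_j [set X | ~ O i j X X].
exists D.
  apply/Pi03P; exists (fun i j => [set X | ~ O i j X X]) => // i j.
  apply/open_cantorP => X /= /contrapT[n Xn].
  (* The first [n] bits fix the position [k] that is queried, the first [k.+1] bits fix the
     answer. *)
  set k := npair _ _ in Xn; exists (maxn n k.+1) => Y /= YX; apply; exists n.
  rewrite (first_bits_le (leq_maxl _ _) YX) -/k.
  by have /first_bitsP -> := YX; rewrite // leq_maxr.
rewrite -[D in Sigma0 3 D]setCK => /Pi03P[H oH DH].
(* Bit [<i, <j, w>>] of [X0] records that the cylinder of [w] misses [H i j], so the open sets coded
   by [X0] are the complements of the [H i j]. *)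
pose X0 : cantor_space := fun m => `[< exists2 w, str_code w = nsnd (nsnd m) &
  forall Y, first_bits Y (size w) = w -> ~ H (nfst m) (nfst (nsnd m)) Y >].
have OH i j Y : O i j X0 Y <-> ~ H i j Y.
  split=> [[n /asboolP[w]]|HY].
    rewrite !(nfst_npair, nsnd_npair) => /str_code_inj ->.
    by apply; rewrite size_first_bits.
  have /open_cantorP/(_ Y HY)[n nH] := oH i j.
  exists n; apply/asboolP; exists (first_bits Y n).
    by rewrite !nsnd_npair.
  by rewrite !(nfst_npair, nsnd_npair) size_first_bits => Z /nH.
have : D X0 <-> (~` D) X0.
  rewrite DH; split=> DX i _; have [j _ jX] := DX i I; exists j => //.
    by apply: contrapT => /OH.
  by move=> /OH.
by rewrite /setC /=; tauto.
Qed.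

(** * Gales and strong dimension *)

Lemma ltr_powR2 (R : realType) (s t : R) : (2 `^ s < 2 `^ t) = (s < t).
Proof.
rewrite -[LHS]ltr_ln ?posrE ?powR_gt0// !ln_powR ltr_pM2r//.
by rewrite ln_gt0// ltr1n.
Qed.

Lemma powR2_inj (R : realType) : injective (fun s : R => 2 `^ s).
Proof.
move=> s t /= st; apply/le_anti; rewrite !leNgt -(ltr_powR2 s t).
by rewrite -(ltr_powR2 t s) st ltxx.
Qed.

(** Exponents are chosen below as logarithms of rationals, which keeps the betting factors
    rational. *)
Lemma powR2_log (R : realType) (c : R) : 0 < c -> 2 `^ (ln c / ln 2) = c.
Proof.
move=> c0; apply: ln_inj; rewrite ?posrE ?powR_gt0//.
by rewrite ln_powR divfK// gt_eqF// ln_gt0// ltr1n.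
Qed.

Lemma expr_gt_eventually (R : realType) (c M : R) : 1 < c ->
  exists N, forall n, (N <= n)%N -> M < c ^+ n.
Proof.
move=> c1; have h0 : 0 < c - 1 by rewrite subr_gt0.
have bern n : 1 + n%:R * (c - 1) <= c ^+ n.
  elim: n => [|n IHn]; first by rewrite mul0r addr0 expr0.
  have n0 : 0 <= n%:R :> R by [].
  have := ler_wpM2l (ltW (lt_trans ltr01 c1)) IHn.
  have := mulr_ge0 n0 (mulr_ge0 (ltW h0) (ltW h0)).
  by rewrite -exprS -natr1; nra.
have [N MN] : exists N : nat, M / (c - 1) < N%:R.
  exists (Num.bound `|M / (c - 1)|).
  exact: le_lt_trans (ler_norm _) (archi_boundP (normr_ge0 _)).
exists N => n Nn; apply: lt_le_trans (bern n).
rewrite ltr_pdivrMr// in MN; apply: lt_le_trans MN _.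
by rewrite -[leLHS]add0r lerD// ler_wpM2r// ?ler_nat// ltW.
Qed.

Lemma exists_invr_lt (R : realType) (e : R) : 0 < e ->
  exists k, forall n, (k <= n)%N -> n.+1%:R^-1 < e.
Proof.
move=> e0; exists (Num.bound e^-1) => n kn; rewrite invf_plt ?posrE//.
apply: lt_trans (archi_boundP _) _; first by rewrite invr_ge0 ltW.
by rewrite ltr_nat ltnS.
Qed.

Lemma lower_semicomputable_ratio (R : realType) (p q : nat -> nat)
    (d : seq bool -> R) :
  computable p -> computable q ->
  (forall w, (0 < q (str_code w))%N) ->
  (forall w, d w = (p (str_code w))%:R / (q (str_code w))%:R) ->
  lower_semicomputable d.
Proof.
move=> cp cq q0 dE.
have cf := computable_nfst computable_id.
(* The approximation is constant in time; the predecessor compensates for the successor that the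
   definition applies to denominators. *)
exists (fun n => p (nfst n)), (fun n => (q (nfst n)).-1); split.
- exact: computable_comp cp cf.
- exact: computable_pred (computable_comp cq cf).
move=> w /=.
have -> : (fun t => (p (nfst (npair (str_code w) t)))%:R /
    (q (nfst (npair (str_code w) t))).-1.+1%:R) = (fun=> d w) :> (nat -> R).
  by apply/funext => t; rewrite nfst_npair prednK// dE.
by split; [move=> *; exact: lexx|exact: cvg_cst].
Qed.

Lemma lower_semicomputable_scale (R : realType) (k : nat) (d : seq bool -> R) :
  (0 < k)%N -> lower_semicomputable d ->
  lower_semicomputable (fun w => (k.+1%:R / k%:R) ^+ size w * d w).
Proof.
move=> k0 [p [q [cp cq dpq]]].
have [len clen lenE] : exists2 h, computable h &
    forall w, h (str_code w) = foldl (fun z (_ : bool) => z.+1) 0%N w.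
  by apply: computable_foldl; exact/computable_succ/computable_nfst/computable_id.
have {lenE} lenE w : len (str_code w) = size w.
  by rewrite lenE -[RHS]addn0; elim: w 0%N => [|b w IHw] z //=; rewrite IHw addnS.
have ce := computable_comp clen (computable_nfst computable_id).
exists (fun n => k.+1 ^ len (nfst n) * p n)%N,
       (fun n => (k ^ len (nfst n) * (q n).+1).-1)%N; split.
- exact: computable_muln (computable_expn _ ce) cp.
- apply: computable_pred (computable_muln (computable_expn _ ce) _).
  exact: computable_succ.
move=> w; have [nd cv] := dpq w.
set e := npair (str_code w) in nd cv *.
have -> : (fun t => (k.+1 ^ len (nfst (e t)) * p (e t))%:R /
    (k ^ len (nfst (e t)) * (q (e t)).+1).-1.+1%:R) =
  (fun t => (k.+1%:R / k%:R) ^+ size w * ((p (e t))%:R / (q (e t)).+1%:R))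
  :> (nat -> R).
  apply/funext => t; rewrite prednK; last by rewrite muln_gt0 expn_gt0 k0.
  rewrite nfst_npair lenE expr_div_n !natrM !natrX; field.
  by rewrite !lt0r_neq0//= ?exprn_gt0// ltr0n.
split; last exact: cvgMr.
move=> m n mn; apply: ler_wpM2l; first by rewrite exprn_ge0// divr_ge0.
exact: nd.
Qed.

Lemma gale_scale (R : realType) (s t c : R) (d : seq bool -> R) :
  0 < c -> 2 `^ t = c -> gale s d ->
  gale (s + t) (fun w => c ^+ size w * d w).
Proof.
move=> c0 tc [d0 dE]; split=> w; first by rewrite mulr_ge0// exprn_ge0// ltW.
rewrite !size_rcons exprS -!mulrA -!mulrDr -dE powRD ?tc; first by ring.
by apply/implyP => _; rewrite pnatr_eq0.
Qed.

Lemma succeeds_stronglyP (R : realType) (d : seq bool -> R) A :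
  succeeds_strongly d A <->
  forall M, exists N, forall n, (N <= n)%N -> M < d (first_bits A n).
Proof.
rewrite /succeeds_strongly; set u := fun n => _; split=> [uy M|du].
  have : einfs u @ \oo --> +oo%E.
    have := @is_cvg_einfs R u; rewrite limn_einf_lim in uy.
    by rewrite -uy.
  move=> /cvgeyPge/(_ (M + 1))[N _ Nu]; exists N => n Nn.
  rewrite -(ltrD2r 1) -lte_fin.
  apply: (@le_lt_trans _ _ (u n)).
    apply: le_trans (Nu N (leqnn N)) _; apply: ereal_inf_lbound.
    by exists n.
  by rewrite lte_fin ltrDl.
rewrite (cvg_limn_einf_sup (_ : u @ \oo --> +oo%E)).1//.
apply/cvgeyPge => M; have [N MN] := du M; exists N => // n /= Nn.
by rewrite lee_fin ltW// MN.
Qed.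

(* Numerator and denominator are carried along the word by a single
   [foldl], together with the current position. *)
Lemma exists_betting_gale (R : realType) (F : pred nat) (u v : nat) (s : R) :
  computable (fun i => F i : nat) -> (0 < v)%N -> 2 `^ s = u%:R / v%:R ->
  exists d, [/\ gale s d, lower_semicomputable d, d [::] = 1 &
    forall w b, d (rcons w b) = d w *
      (if F (size w) then u%:R / (2 * v)%:R else
       if b then 0 else u%:R / v%:R)].
Proof.
move=> cF v0 sE.
pose pos z := nfst z; pose num z := nfst (nsnd z); pose den z := nsnd (nsnd z).
pose step z (b : bool) := npair (pos z).+1
  (npair (if F (pos z) then num z * u else if b then 0 else num z * u)
         (if F (pos z) then den z * (2 * v) else den z * v))%N.
have cpos : computable pos := computable_nfst computable_id.
have cnum : computable num := computable_nfst (computable_nsnd computable_id).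
have cden : computable den := computable_nsnd (computable_nsnd computable_id).
have cst := computable_comp _ (computable_nfst computable_id).
have [h ch hE] : exists2 h, computable h &
    forall w, h (str_code w) = foldl step (npair 0 (npair 1 1)) w.
  apply: computable_foldl.
  apply: computable_pair; first exact: computable_succ (cst _ cpos).
  have cFp := computable_comp cF (cst _ cpos).
  apply: computable_pair.
    apply: computable_if => //.
      exact: computable_muln (cst _ cnum) (computable_const _).
    apply: computable_if; [|exact: computable_const|].
      by apply: computable_odd (computable_nsnd computable_id).
    exact: computable_muln (cst _ cnum) (computable_const _).
  by apply: computable_if => //;
    exact: computable_muln (cst _ cden) (computable_const _).
have hS w b : h (str_code (rcons w b)) = step (h (str_code w)) b.
  by rewrite !hE foldl_rcons.
have posE w : pos (h (str_code w)) = size w.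
  elim/last_ind: w => [|w b IHw]; first by rewrite hE /pos nfst_npair.
  by rewrite hS /step /pos nfst_npair -/(pos _) IHw size_rcons.
have denS w b : den (h (str_code (rcons w b))) =
    (den (h (str_code w)) * if F (size w) then 2 * v else v)%N.
  by rewrite hS /step {1}/den !nsnd_npair posE; case: ifP.
have numS w b : num (h (str_code (rcons w b))) =
    (num (h (str_code w)) * if F (size w) then u else if b then 0 else u)%N.
  rewrite hS /step {1}/num nsnd_npair nfst_npair posE.
  by case: ifP => // _; case: b; rewrite ?muln0.
have den0 w : (0 < den (h (str_code w)))%N.
  elim/last_ind: w => [|w b IHw]; first by rewrite hE /den !nsnd_npair.
  by rewrite denS muln_gt0 IHw; case: ifP; rewrite ?muln_gt0 v0.
pose d w : R := (num (h (str_code w)))%:R / (den (h (str_code w)))%:R.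
have dS w b : d (rcons w b) = d w *
    (if F (size w) then u%:R / (2 * v)%:R else if b then 0 else u%:R / v%:R).
  rewrite /d numS denS; case: ifP => _; first by rewrite !natrM !invfM; ring.
  by case: b; rewrite ?(muln0, mul0r, mulr0)// !natrM invfM; ring.
exists d; split=> //.
- split=> [w|w]; first exact: divr_ge0.
  have v0' : v%:R != 0 :> R by rewrite pnatr_eq0 -lt0n.
  rewrite !dS sE; case: ifP => _; last by ring.
  by rewrite natrM; field.
- apply: (@lower_semicomputable_ratio _ (num \o h) (den \o h)) => //.
    exact: (computable_comp cnum ch).
  exact: (computable_comp cden ch).
- by rewrite /d (hE [::]) /num /den !nsnd_npair nfst_npair divr1.
Qed.

Lemma Dim_ltP (R : realType) (A : cantor_space) (q : R) :
  Dim R A < q <-> exists s d, [/\ 0 <= s < q, gale s d, lower_semicomputable d &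
    exists N, forall n, (N <= n)%N -> 1 < d (first_bits A n)].
Proof.
rewrite /Dim; set S := [set s | _].
have S0 : lbound S 0 by move=> s [].
(* A factor [k.+1 / k] between 1 and [2 ^ (q' - s)] has powers that drive a gale staying above 1 to
   infinity, at an exponent still below [q']. *)
have shift s d q' : 0 <= s -> s < q' -> gale s d -> lower_semicomputable d ->
    (exists N, forall n, (N <= n)%N -> 1 < d (first_bits A n)) ->
    exists2 s', S s' & s' < q'.
  move=> s0 sq gd ld [N Nd].
  have e1 : 1 < 2 `^ (q' - s) by rewrite -[ltLHS](powRr0 (2 : R)) ltr_powR2 subr_gt0.
  have [k k0 ke] : exists2 k : nat, (0 < k)%N & k.+1%:R / k%:R < 2 `^ (q' - s).
    set e := 2 `^ _ in e1 *; have h0 : 0 < e - 1 by rewrite subr_gt0.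
    have h1 : 0 <= (e - 1)^-1 by rewrite invr_ge0 ltW.
    have := archi_boundP h1; set m := Num.bound _ => em.
    have m0 : 0 < m%:R :> R by exact: le_lt_trans em.
    exists m; first by rewrite -(ltr0n R).
    rewrite ltr_pdivrMr// -natr1.
    have : 1 < m%:R * (e - 1) by rewrite -ltr_pdivrMr// div1r.
    by lra.
  set c := _ / _ in ke; pose t := ln c / ln 2.
  have c1 : 1 < c by rewrite /c ltr_pdivlMr ?ltr0n// mul1r ltr_nat.
  have c0 : 0 < c by rewrite (lt_trans ltr01).
  have tE : 2 `^ t = c := powR2_log c0.
  have t0 : 0 < t by rewrite -(@ltr_powR2 R) powRr0 tE.
  have tq : t < q' - s by rewrite -(@ltr_powR2 R) tE.
  exists (s + t); last by lra.
  split; first by lra.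
  exists (fun w => c ^+ size w * d w); split.
  - exact: gale_scale.
  - exact: lower_semicomputable_scale.
  apply/succeeds_stronglyP => M; have [N' MN] := @expr_gt_eventually R c M c1.
  exists (maxn N N') => n; rewrite geq_max => /andP[Nn N'n].
  rewrite size_first_bits; apply: lt_le_trans (MN _ N'n) _.
  by rewrite ler_peMr ?exprn_ge0 ?ltW// Nd.
(* Even bets at exponent 2 double the capital at every bit. *)
have Sn0 : S !=set0.
  have e4 : 2 `^ 2 = 4%:R / 1%:R :> R by rewrite powR_mulrn//; lra.
  have [d [gd ld d0 dS]] :=
    @exists_betting_gale R xpredT 4 1 2 (computable_const 1) isT e4.
  have dE n : d (first_bits A n) = 2 ^+ n.
    elim: n => [|n IHn]; first by rewrite d0 expr0.
    by rewrite first_bitsS dS IHn exprSr; congr (_ * _); lra.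
  have [|||s Ss _] := shift 2 d 3 _ _ gd ld; rewrite ?ler0n ?ltr_nat//.
    by exists 1%N => -[//|n] _; rewrite dE exprn_egt1// ltr1n.
  by exists s.
split=> [/(inf_lt Sn0)[s [s0 [d [gd ld /succeeds_stronglyP/(_ 1) ?]]] sq]|].
  by exists s, d; rewrite s0 sq.
move=> [s [d [/andP[s0 sq] gd ld Ad]]].
have [s' Ss' sq'] := shift s d q s0 sq gd ld Ad.
by apply: le_lt_trans sq'; apply: ge_inf => //; exists 0.
Qed.

(** * Enumeration of the lower semicomputable gales *)

Fixpoint code_nat (c : code) : nat :=
  match c with
  | Zero => 0
  | Succ => 1
  | Fst => 2
  | Snd => 3
  | Pair f g => 4 + 4 * npair (code_nat f) (code_nat g)
  | Comp f g => 5 + 4 * npair (code_nat f) (code_nat g)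
  | Prec f g => 6 + 4 * npair (code_nat f) (code_nat g)
  | Mu f => 7 + 4 * code_nat f
  end.

Lemma npair_inj x y u v : npair x y = npair u v -> x = u /\ y = v.
Proof.
by move=> e; rewrite -(nfst_npair x y) -{2}(nsnd_npair x y) e nfst_npair nsnd_npair.
Qed.

(** The atomic codes take the values below 4; from 4 on, the residue modulo 4 tells the
    constructor. *)
Lemma code_nat_inj : injective code_nat.
Proof.
elim=> [||||f IHf g IHg|f IHf g IHg|f IHf g IHg|f IHf];
  case=> [||||f' g'|f' g'|f' g'|f'] //= e; try lia.
1-3: by have /npair_inj[/IHf -> /IHg ->] :
    npair (code_nat f) (code_nat g) = npair (code_nat f') (code_nat g') by lia.
by have /IHf -> : code_nat f = code_nat f' by lia.
Qed.

Lemma gale_exponent_inj (R : realType) (s t : R) (d : seq bool -> R) w :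
  d w != 0 -> gale s d -> gale t d -> s = t.
Proof.
move=> dw [_ sd] [_ td]; apply/powR2_inj/(mulIf dw).
by rewrite sd td.
Qed.

(** Two programs, for numerators and denominators, determine [d], and a gale that is nonzero
    somewhere determines its exponent; so real exponents do not make the family uncountable. *)
Lemma enumerate_gales (R : realType) : exists E : nat -> R * (seq bool -> R),
  (forall e, gale (E e).1 (E e).2) /\
  forall s d w, gale s d -> lower_semicomputable d -> d w != 0 ->
    exists e, E e = (s, d).
Proof.
pose coded e (d : seq bool -> R) := exists cp cq p q,
  [/\ e = npair (code_nat cp) (code_nat cq), (forall n, eval cp n (p n)),
      (forall n, eval cq n (q n)) &
      forall w, ((p (npair (str_code w) t))%:R
                 / (q (npair (str_code w) t)).+1%:R : R) @[t --> \oo] --> d w].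
have coded_inj e d d' : coded e d -> coded e d' -> d = d'.
  move=> [cp [cq [p [q [-> pE qE dE]]]]] [cp' [cq' [p' [q' [+ pE' qE' dE']]]]].
  move=> /npair_inj[/code_nat_inj ecp /code_nat_inj ecq]; subst cp' cq'.
  have ep : p' = p by apply/funext => n; apply: eval_det (pE' n) (pE n).
  have eq' : q' = q by apply/funext => n; apply: eval_det (qE' n) (qE n).
  subst p' q'; apply/funext => w.
  exact: cvg_unique (dE w) (dE' w).
have lsc_coded d : lower_semicomputable d -> exists e, coded e d.
  move=> [p [q [[cp cpE] [cq cqE] dE]]].
  exists (npair (code_nat cp) (code_nat cq)), cp, cq, p, q; split=> // w.
  by have [] := dE w.
have /choice[E EP] e : exists sd : R * (seq bool -> R), gale sd.1 sd.2 /\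
    forall s d w, gale s d -> coded e d -> d w != 0 -> sd = (s, d).
  have [[s [d [w [gd cd dw]]]]|none] :=
    pselect (exists s d w, [/\ gale s d, coded e d & d w != 0]).
    exists (s, d); split=> // s' d' w' gd' cd' dw'.
    have e' := coded_inj _ _ _ cd cd'; subst d'.
    by rewrite (gale_exponent_inj dw gd gd').
  (* An index of no nonzero gale gets the zero gale, so that every [E e] is a gale. *)
  exists (0, fun=> 0); split=> [|s d w gd cd dw].
    by split=> w //=; rewrite mulr0 addr0.
  by case: none; exists s, d, w.
exists E; split=> [e|s d w gd /lsc_coded[e ed] dw]; first by have [] := EP e.
by exists e; have [_] := EP e; apply; eauto.
Qed.

(** The index [j] codes a gale and a threshold. Exceeding 1 from that threshold on is refuted by a
    finite prefix, hence closed. *)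
Lemma Dim_lt_bigcup_closed (R : realType) (q : R) :
  exists2 C : nat -> set cantor_space, forall j, open (~` C j) &
    [set A | Dim R A < q] = \bigcup_j C j.
Proof.
have [E [_ EP]] := @enumerate_gales R.
pose ok e := [/\ 0 <= (E e).1 < q, gale (E e).1 (E e).2 &
                 lower_semicomputable (E e).2].
exists (fun j => [set A | ok (nfst j) /\ forall n, (nsnd j <= n)%N ->
                          1 < (E (nfst j)).2 (first_bits A n)]).
  move=> j; apply/open_cantorP => A /= Aj.
  have [okj|nokj] := pselect (ok (nfst j)); last by exists 0%N => Y _ [].
  have /existsNP[n /not_implyP[jn Dn]] : ~ forall n, (nsnd j <= n)%N ->
    1 < (E (nfst j)).2 (first_bits A n) by move=> h; apply: Aj.
  by exists n => Y YA [_ /(_ n jn)]; rewrite YA.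
apply/seteqP; split=> [A /Dim_ltP[s [d [sq gd ld [N Nd]]]]|A [j _ []]].
  have [e Ee] : exists e, E e = (s, d).
    apply: (EP s d (first_bits A N)) => //.
    by rewrite gt_eqF// (lt_trans ltr01)// Nd.
  exists (npair e N) => //=; rewrite nfst_npair nsnd_npair /ok Ee /=.
  by split.
move=> [sq gd ld] jd; apply/Dim_ltP; exists (E (nfst j)).1, (E (nfst j)).2.
by split=> //; exists (nsnd j).
Qed.

Lemma Pi03_DIM_str (R : realType) (alpha : R) : Pi0 3 (DIM_str alpha).
Proof.
have [C oC CE] := Dim_lt_bigcup_closed alpha.
have /choice[U UP] k : exists U : nat -> set cantor_space,
    (forall j, open (~` U j)) /\
    [set A | Dim R A < alpha + k.+1%:R^-1] = \bigcup_j U j.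
  by have [U oU UE] := Dim_lt_bigcup_closed (alpha + k.+1%:R^-1); exists U.
have /choice[V VP] l : exists V : nat -> set cantor_space,
    (forall j, open (~` V j)) /\ ~` C l = \bigcup_j V j.
  by have [V oV VE] := open_bigcup_closed (oC l); exists V.
(* Even rows say [Dim A < alpha + 1 / (k + 1)]. Odd rows exclude [Dim A < alpha] through the open
   complements of the [C l]. *)
pose G i j := if odd i then V i./2 j else U i./2 j.
apply/Pi03P; exists G => [i j|].
  by rewrite /G; case: odd; [case: (VP i./2)|case: (UP i./2)].
have GE i : \bigcup_j G i j = if odd i then ~` C i./2
                              else [set A | Dim R A < alpha + i./2.+1%:R^-1].
  by rewrite /G; case: odd; [case: (VP i./2)|case: (UP i./2)].
apply/seteqP; split=> [A Aalpha i _|A AG].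
  rewrite /DIM_str /= in Aalpha; rewrite GE; case: odd => /=.
    move=> Ci; have : (\bigcup_j C j) A by exists i./2.
    by rewrite -CE /= Aalpha ltxx.
  by rewrite Aalpha ltrDl invr_gt0.
apply/le_anti/andP; split.
  apply/ler_addgt0Pr => e e0; have [k /(_ k (leqnn k)) ke] := exists_invr_lt e0.
  have := AG k.*2 I; rewrite GE odd_double doubleK /= => /ltW Ak.
  by apply: le_trans Ak _; rewrite lerD2l ltW.
rewrite leNgt; apply/negP => Aalpha.
have : (\bigcup_j C j) A by rewrite -CE.
move=> [l _ Cl]; have := AG l.*2.+1 I.
rewrite GE /= odd_double /= uphalf_double; exact.
Qed.

(** * Free positions *)

(** The length of the diagonal through [j]; [nsnd j] is the position on it, counted from 0. *)
Definition diag (j : nat) : nat := (nfst j + nsnd j).+1.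

Lemma CantorS j :
  [/\ nfst j = 0%N, nsnd j = (diag j).-1, nsnd j.+1 = 0%N &
      diag j.+1 = (diag j).+1] \/
  [/\ nsnd j.+1 = (nsnd j).+1 & diag j.+1 = diag j].
Proof.
rewrite /diag /nfst /nsnd /= -/(Cantor.of_nat j).
case: (Cantor.of_nat j) => -[|x] y /=; [left|right]; split=> //; lia.
Qed.

(** By triangular numbers, [diag j] is of the order of the square root of [j]; this makes the error
    term of [free_count_le] negligible. *)
Lemma Cantor_quadratic j : (j * 2 = nsnd j * 2 + (diag j).-1 * diag j)%N.
Proof.
have := Cantor.to_nat_spec (nfst j) (nsnd j).
rewrite (npairK j : Cantor.to_nat (nfst j, nsnd j) = j) /diag; nia.
Qed.

Section FreePositions.
Variable R : realType.
Implicit Types (rho r s q : R) (A : cantor_space).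

(* On each diagonal of the Cantor pairing the first [rho]-fraction of the
   positions is free, so that these sets have density [rho] and increase
   with [rho]. *)
Definition free rho j : bool := (nsnd j)%:R < rho * (diag j)%:R.

Definition free_count rho n : nat := (\sum_(j < n) free rho j)%N.
Definition forced_count rho n : nat := (\sum_(j < n) ~~ free rho j)%N.

Lemma free_mono rho r j : rho <= r -> free rho j -> free r j.
Proof. by move=> rr jr; apply: lt_le_trans jr _; rewrite ler_wpM2r. Qed.

Lemma free_count_le rho n : 0 <= rho ->
  (free_count rho n)%:R <= rho * n%:R + 2 * (diag n)%:R.
Proof.
move=> rho0.
(* Each completed diagonal costs a rounding error of at most 1. On the current one, the first bound
   counts every position passed as free, the second at most [rho * diag n + 1] of them; the
   induction needs both. *)
suff [+ _] : ((free_count rho n)%:R <=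
    rho * (n%:R - (nsnd n)%:R) + (diag n)%:R - 1 + (nsnd n)%:R /\
  (free_count rho n)%:R <=
    rho * (n%:R - (nsnd n)%:R) + (diag n)%:R + rho * (diag n)%:R).
  have : (nsnd n)%:R <= (diag n)%:R :> R by rewrite ler_nat /diag; lia.
  have : 0 <= rho * (nsnd n)%:R by rewrite mulr_ge0.
  lra.
elim: n => [|n [IH1 IH2]].
  by rewrite /free_count big_ord0 /diag /nfst /nsnd /=; split; lra.
rewrite /free_count big_ord_recr /= -/(free_count rho n) natrD.
have d0 : 0 <= rho * (diag n)%:R by rewrite mulr_ge0.
have [[_ y0 -> ->]|[-> ->]] := CantorS n.
  have e : (nsnd n)%:R = (diag n)%:R - 1 :> R.
    by rewrite y0 -[in RHS](@prednK (diag n))// -natr1; lra.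
  rewrite /free -(natr1 n) -(natr1 (diag n)); rewrite e in IH1 IH2 *.
  move: (diag n)%:R IH1 IH2 d0 => D IH1 IH2 d0.
  by case: ltP => /= h; split; lra.
rewrite /free -(natr1 n) -(natr1 (nsnd n)).
move: (diag n)%:R IH1 IH2 d0 => D IH1 IH2 d0.
by case: ltP => /= h; split; lra.
Qed.

(** A full diagonal has at least a [rho]-fraction of free positions, so no rounding error is left
    where a diagonal starts. The two bounds of the induction hold before and after the first forced
    position of the current diagonal. *)
Lemma forced_count_le rho n : 0 <= rho <= 1 -> nsnd n = 0%N ->
  (forced_count rho n)%:R <= (1 - rho) * n%:R.
Proof.
move=> /andP[rho0 rho1].
suff : (forced_count rho n)%:R <= (1 - rho) * (n%:R - (nsnd n)%:R) \/
  (forced_count rho n)%:R <= (1 - rho) * (n%:R - (nsnd n)%:R)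
                             + (nsnd n)%:R - rho * (diag n)%:R.
  have d0 : 0 <= rho * (diag n)%:R by rewrite mulr_ge0.
  by move=> + e; rewrite e; lra.
elim: n => [|n IH].
  by left; rewrite /forced_count big_ord0 /nsnd /=; lra.
rewrite /forced_count big_ord_recr /= -/(forced_count rho n) natrD.
have [[_ y0 -> ->]|[-> ->]] := CantorS n.
  have e : (nsnd n)%:R = (diag n)%:R - 1 :> R.
    by rewrite y0 -[in RHS](@prednK (diag n))// -natr1; lra.
  have d1 : 1 <= (diag n)%:R :> R by rewrite ler1n.
  have d2 : 0 <= (1 - rho) * (diag n)%:R by rewrite mulr_ge0// subr_ge0.
  rewrite /free -(natr1 n); rewrite e in IH *.
  move: (diag n)%:R IH d1 d2 => D IH d1 d2.
  by left; move: IH; case: ltP => /= h [] IH; lra.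
rewrite /free -(natr1 n) -(natr1 (nsnd n)).
move: (diag n)%:R IH => D IH.
case: ltP => /= h.
  by left; case: IH => IH; lra.
by right; case: IH => IH; lra.
Qed.

Lemma free_ratio a b j : (0 < b)%N ->
  free (a%:R / b%:R) j = (nsnd j * b < a * diag j)%N.
Proof.
move=> b0; rewrite /free mulrAC ltr_pdivlMr ?ltr0n//.
by rewrite -!natrM ltr_nat.
Qed.

Lemma computable_diag : computable diag.
Proof.
apply/computable_succ/computable_addn.
  exact: computable_nfst computable_id.
exact: computable_nsnd computable_id.
Qed.

Lemma exists_ratio (x y : R) : 0 <= x -> x < y ->
  exists a b, (0 < b)%N /\ x < a%:R / b%:R < y.
Proof.
move=> x0 /rat_in_itvoo[r]; rewrite in_itv /= => /andP[xr ry].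
have r0 : 0 < r by rewrite -(ltr0q R) (le_lt_trans x0).
exists `|numq r|%N, `|denq r|%N; split; first by rewrite absz_gt0 denq_neq0.
have -> : (`|numq r|%N)%:R / (`|denq r|%N)%:R = ratr r :> R.
  by rewrite /ratr !natr_absz !ger0_norm ?denq_ge0// numq_ge0 ltW.
by rewrite xr ry.
Qed.

Lemma Dim_lt_free A rho q : 0 <= rho -> rho < q ->
  (exists N, forall j, (N <= j)%N -> A j -> free rho j) -> Dim R A < q.
Proof.
move=> rho0 rhoq [N0 Afree].
have [a [b [b0 /andP[rhor rq]]]] := exists_ratio rho0 rhoq.
set r := a%:R / b%:R in rhor rq.
have r0 : 0 <= r by exact: ltW (le_lt_trans rho0 rhor).
have [u [v [v0 /andP[ru uq]]]] : exists u v, (0 < v)%N /\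
    (2 `^ r : R) < u%:R / v%:R < 2 `^ q.
  by apply: exists_ratio; rewrite ?powR_ge0// ltr_powR2.
set c := u%:R / v%:R in ru uq; pose s := ln c / ln 2.
have c0 : 0 < c by rewrite (lt_trans _ ru)// powR_gt0.
have sE : 2 `^ s = c := powR2_log c0.
have rs : r < s by rewrite -ltr_powR2 sE.
have sq : s < q by rewrite -ltr_powR2 sE.
(* The first [N0] positions count as free, so that the gale never loses everything along [A]. *)
pose F j := (j < N0)%N || free r j.
have cF : computable (fun j => F j : nat).
  have := computable_if
    (computable_ltn computable_id (computable_const N0))
    (computable_const 1)
    (computable_ltn
      (computable_muln (computable_nsnd computable_id) (computable_const b))
      (computable_muln (computable_const a) computable_diag)).
  congr computable; apply/funext => j; rewrite /F free_ratio//.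
  by case: ltnP.
have [d [gd ld d0 dS]] := exists_betting_gale cF v0 sE.
pose k n := (\sum_(j < n) F j)%N.
have kS n : k n.+1 = (k n + F n)%N by rewrite /k big_ord_recr.
have dE n : d (first_bits A n) = 2 `^ (s * n%:R - (k n)%:R).
  elim: n => [|n IHn]; first by rewrite d0 /k big_ord0 mulr0 subrr powRr0.
  rewrite first_bitsS dS IHn size_first_bits kS.
  rewrite -(natr1 n) (natrD _ (k n)) mulrDr mulr1; case: ifP => [Fn|/negbT Fn].
    have -> : s * n%:R + s - ((k n)%:R + true%:R) =
      (s * n%:R - (k n)%:R) + (s - 1) by rewrite /=; lra.
    rewrite [RHS]powRD; last by apply/implyP; rewrite pnatr_eq0.
    rewrite (@powRD _ 2 s (- 1)); last by apply/implyP; rewrite pnatr_eq0.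
    by rewrite sE powR_inv1// natrM invfM /c; congr (_ * _); ring.
  have -> : A n = false.
    apply/negbTE/negP => An; move: Fn; rewrite negb_or -leqNgt => /andP[Nn].
    by rewrite (free_mono (ltW rhor))// Afree.
  rewrite -/c -sE -powRD; last by apply/implyP; rewrite pnatr_eq0.
  by congr (2 `^ _); rewrite /=; lra.
have kle n : (k n)%:R <= N0%:R + (r * n%:R + 2 * (diag n)%:R).
  apply: le_trans (lerD (lexx _) (free_count_le n r0)).
  rewrite -natrD ler_nat /k; elim: n => [|n IHn]; first by rewrite big_ord0.
  have [nN|nN] := ltnP n N0.
    apply: (@leq_trans n.+1); last exact: leq_trans nN (leq_addr _ _).
    rewrite -[X in (_ <= X)%N]card_ord -sum1_card; apply: leq_sum => i _.
    by case: (F i).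
  rewrite /free_count !big_ord_recr /= -/(free_count r n) addnA.
  by apply: leq_add => //; rewrite /F ltnNge nN.
apply/Dim_ltP; exists s, d; split=> //.
  by rewrite sq (ltW (le_lt_trans r0 rs)).
have e0 : 0 < s - r by rewrite subr_gt0.
set e := s - r in e0.
(* By [amgm], the square-root term uses up half of [e * n] and a constant; beyond [B] the other half
   covers the constants. *)
pose B : R := (N0%:R + 2 + 4 / e) / (e / 2).
exists (Num.bound B) => n Bn; rewrite dE -[ltLHS](powRr0 (2 : R)) ltr_powR2.
have : B < n%:R.
  apply: lt_le_trans (archi_boundP _) _; last by rewrite ler_nat.
  have eW : 0 <= e by exact: ltW.
  by rewrite /B; do !(apply: divr_ge0 || apply: addr_ge0) => //.
rewrite /B ltr_pdivrMr ?divr_gt0// => eB.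
have := kle n; set y : R := (diag n)%:R - 1.
have yn : y * y <= 2 * n%:R.
  rewrite /y -[diag n]prednK// -natr1 addrK -!natrM ler_nat.
  rewrite [X in (_ <= X)%N]mulnC Cantor_quadratic.
  by apply: leq_trans (leq_addl _ _); rewrite leq_mul2l leq_pred orbT.
have amgm : 2 * y <= e / 4 * (y * y) + 4 / e.
  rewrite -subr_ge0.
  have -> : e / 4 * (y * y) + 4 / e - 2 * y = (e * y - 4) ^+ 2 / (4 * e).
    by field; rewrite gt_eqF.
  by rewrite divr_ge0 ?sqr_ge0// mulr_ge0// ltW.
have : e / 4 * (y * y) <= e / 4 * (2 * n%:R).
  by apply: ler_wpM2l => //; rewrite divr_ge0// ltW.
have -> : (diag n)%:R = y + 1 by rewrite /y subrK.
have -> : s = e + r by rewrite /e subrK.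
by lra.
Qed.

End FreePositions.

(** * Points that defeat all gales *)

Section Path.
Variable R : realType.
Implicit Types (rho : nat -> R) (M : nat -> seq bool -> R) (w : seq bool).

(* When [M] would grow on [0], it does not grow on [1], by the gale identity. *)
Definition next_bit (r : R) (M : seq bool -> R) w : bool :=
  free r (size w) && (M w < M (rcons w false)).

Fixpoint path_to rho M n : seq bool :=
  if n is j.+1 then
    let w := path_to rho M j in rcons w (next_bit (rho j) (M j) w)
  else [::].

Definition path_point rho M : cantor_space :=
  fun j => next_bit (rho j) (M j) (path_to rho M j).

Lemma first_bits_path rho M n : first_bits (path_point rho M) n = path_to rho M n.
Proof. by elim: n => // n IHn; rewrite first_bitsS IHn. Qed.

Lemma size_path_to rho M n : size (path_to rho M n) = n.
Proof. by elim: n => //= n IHn; rewrite size_rcons IHn. Qed.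

Lemma eq_path_to rho rho' M n : (forall j, (j < n)%N -> rho j = rho' j) ->
  path_to rho M n = path_to rho' M n.
Proof.
elim: n => //= n IHn rr; rewrite rr// IHn// => j jn.
exact/rr/(leq_trans jn).
Qed.

Lemma path_point_free rho M j : path_point rho M j -> free (rho j) j.
Proof. by move=> /andP[]; rewrite size_path_to. Qed.

Lemma gale1_rcons (M : seq bool -> R) w b : gale 1 M -> M (rcons w b) <= 2 * M w.
Proof.
move=> [M0 /(_ w)]; rewrite powRr1// => ->.
by case: b; rewrite ?lerDl ?lerDr.
Qed.

Lemma gale1_next_bit (r : R) (M : seq bool -> R) w : gale 1 M ->
  M (rcons w (next_bit r M w)) <= 2 ^+ (~~ free r (size w)) * M w.
Proof.
move=> gM; rewrite /next_bit; case: free => /=; last first.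
  by rewrite expr1; exact: gale1_rcons.
rewrite expr0 mul1r; case: gM => _ /(_ w); rewrite powRr1//.
by case: ltP => // h; lra.
Qed.

Lemma gale1_le (M : seq bool -> R) w : gale 1 M -> M w <= 2 ^+ size w * M [::].
Proof.
move=> gM; elim/last_ind: w => [|w b IHw]; first by rewrite expr0 mul1r.
apply: le_trans (gale1_rcons _ _ gM) _.
by rewrite size_rcons exprS -mulrA ler_wpM2l.
Qed.

(** Each of the [L] bits before the block may double [M']; inside the block only forced bits can. *)
Lemma path_block rho M (r : R) (M' : seq bool -> R) L N : gale 1 M' ->
  (forall j, (L <= j < N)%N -> rho j = r /\ M j = M') ->
  M' (path_to rho M N) <= 2 ^+ (forced_count r N + L) * M' [::].
Proof.
move=> gM; have M0 : 0 <= M' [::] by case: gM.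
elim: N => [|N IHN] block.
  by rewrite ler_peMl// exprn_ege1// ler1n.
case: (ltnP N L) => [NL|LN].
  apply: le_trans (gale1_le _ gM) _; rewrite size_path_to.
  apply: ler_wpM2r => //; apply: ler_weXn2l; first by rewrite ler1n.
  by rewrite (leq_trans NL)// leq_addl.
have [rN MN] : rho N = r /\ M N = M' by apply: block; rewrite LN leqnn.
rewrite /= rN// MN//; apply: le_trans (gale1_next_bit _ _ gM) _.
rewrite size_path_to /forced_count big_ord_recr /= -/(forced_count r N).
rewrite addnAC addnC exprD -mulrA ler_wpM2l ?exprn_ge0//.
by apply: IHN => j /andP[Lj jN]; apply: block; rewrite Lj ltnW.
Qed.

End Path.

(** * Blocks, and the finitely many gales opposed on each *)

Lemma gale_sum (R : realType) (s : R) n (d : nat -> seq bool -> R) :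
  (forall e, gale s (d e)) -> gale s (fun w => \sum_(e < n) d e w).
Proof.
move=> gd; split=> w; first by apply: sumr_ge0 => e _; have [] := gd e.
rewrite mulr_sumr -big_split; apply: eq_bigr => e _.
by have [_ ->] := gd e.
Qed.

Lemma leq_npair0 k : (k <= npair k 0)%N.
Proof. by apply/ssrnat.leP; exact: (Cantor.to_nat_non_decreasing k 0). Qed.

Section Construction.
Variables (R : realType) (E : nat -> R * (seq bool -> R)).
Hypothesis galeE : forall e, gale (E e).1 (E e).2.

(** Rescaling to the common exponent 1 lets gales of different exponents be added and opposed as
    one. *)
Definition capital n w : R :=
  \sum_(e < n) (2 `^ (1 - (E e).1)) ^+ size w * (E e).2 w.

Lemma gale_capital n : gale 1 (capital n).
Proof.
apply: (@gale_sum R 1 n (fun e w =>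
  (2 `^ (1 - (E e).1)) ^+ size w * (E e).2 w)) => e.
have c0 : 0 < 2 `^ (1 - (E e).1) :> R by rewrite powR_gt0.
by have := gale_scale c0 erefl (galeE e); rewrite addrC subrK.
Qed.

(** Pairing with 0 puts each boundary at the start of a diagonal, as [forced_count_le] requires. The
    factor [n'.+1] makes the earlier bits and the initial capital a small fraction of the length. *)
Fixpoint boundary n : nat :=
  if n is n'.+1 then
    npair (n'.+1 * (boundary n' + Num.bound (capital n' [::]))).+1 0
  else 0%N.

Lemma boundary_lt n : (boundary n < boundary n.+1)%N.
Proof.
rewrite /=; apply: leq_trans (leq_npair0 _); rewrite ltnS.
by rewrite (leq_trans (leq_addr (Num.bound (capital n [::])) _))// leq_pmull.
Qed.

Lemma boundary_mono m n : (m <= n)%N -> (boundary m <= boundary n)%N.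
Proof.
move=> mn; rewrite -(subnK mn); elim: (n - m)%N => // k IHk.
exact: leq_trans IHk (ltnW (boundary_lt _)).
Qed.

Lemma leq_boundary n : (n <= boundary n)%N.
Proof. by elim: n => // n IHn; exact: leq_ltn_trans IHn (boundary_lt n). Qed.

Lemma sum_ltn n j : (\sum_(i < j) (i < n) = minn n j)%N.
Proof.
by elim: j => [|j IHj]; rewrite ?big_ord0 ?big_ord_recr/= ?IHj; case: ltnP; lia.
Qed.

(** Summing over [i < j] only misses no boundary, since [boundary i.+1] exceeds [i]. *)
Definition block (j : nat) : nat := (\sum_(i < j) (boundary i.+1 <= j))%N.

Lemma block_le j : (block j <= j)%N.
Proof.
rewrite -[X in (_ <= X)%N]card_ord -sum1_card; apply: leq_sum => i _.
by case: leqP.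
Qed.

Lemma blockE n j : (boundary n <= j < boundary n.+1)%N -> block j = n.
Proof.
move=> /andP[nj jn]; have nlej := leq_trans (leq_boundary n) nj.
have bE i : (boundary i.+1 <= j)%N = (i < n)%N.
  apply/idP/idP => [|ltin]; last exact: leq_trans (boundary_mono ltin) nj.
  by apply: contraLR; rewrite -leqNgt -ltnNge => ni;
    exact: leq_trans jn (boundary_mono _).
rewrite /block (eq_bigr (fun i : 'I_j => (i < n)%N : nat)).
  by rewrite sum_ltn; lia.
by move=> i _; rewrite bE.
Qed.

Lemma block_ge n j : (boundary n <= j)%N -> (n <= block j)%N.
Proof.
move=> nj; have nlej := leq_trans (leq_boundary n) nj.
rewrite -[X in (X <= _)%N](minn_idPl nlej) -sum_ltn; apply: leq_sum => i _.
by case: ltnP => // ltin; rewrite (leq_trans (boundary_mono ltin)).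
Qed.

Lemma capital_ge e n w : (e < n)%N ->
  (2 `^ (1 - (E e).1)) ^+ size w * (E e).2 w <= capital n w.
Proof.
move=> en; rewrite /capital (bigD1 (Ordinal en))//= lerDl.
apply: sumr_ge0 => i _; rewrite mulr_ge0 ?exprn_ge0 ?powR_ge0//.
by have [] := galeE i.
Qed.

(** At the end [N] of block [n], forced bits have allowed at most [(1 - rho n) * N] doublings;
    earlier bits and the initial capital account for at most [N / (n + 1)] more. The total is at
    most [(1 - (E e).1) * N], the exponent of the factor that gale [e] carries in [capital]. *)
Lemma path_defeats (rho : nat -> R) e n : (e < n)%N -> 0 <= rho n <= 1 ->
  (E e).1 < rho n - n.+1%:R^-1 ->
  (E e).2 (first_bits (path_point (rho \o block) (capital \o block))
                      (boundary n.+1)) <= 1.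
Proof.
have budget (r s x f l b i : R) : f <= (1 - r) * x -> l + b <= i * x ->
    s * x <= (r - i) * x -> f + l + b <= (1 - s) * x by lra.
move=> en rho01 se; rewrite first_bits_path.
set N := boundary n.+1; set L := boundary n.
set p := path_to _ _ N; set r := rho n in rho01 se *; set s := (E e).1 in se *.
have pE : capital n p <= 2 ^+ (forced_count r N + L) * capital n [::].
  apply: path_block; first exact: gale_capital.
  by move=> j /blockE /= ->.
have forcedE : (forced_count r N)%:R <= (1 - r) * N%:R.
  by apply: forced_count_le; rewrite // /N /= nsnd_npair.
have capE : capital n [::] <= 2 ^+ Num.bound (capital n [::]).
  have c0 : 0 <= capital n [::] by have [] := gale_capital n.
  apply: le_trans (ltW (archi_boundP c0)) _.
  by rewrite -natrX ler_nat ltnW// ltn_expl.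
set B := Num.bound _ in capE.
have NB : n.+1%:R * (L%:R + B%:R) <= N%:R :> R.
  rewrite -natrD -natrM ler_nat /N /= -/L -/B.
  exact: ltnW (leq_npair0 _).
have dE : (2 `^ (1 - s)) ^+ N * (E e).2 p <= 2 ^+ (forced_count r N + L + B).
  have := capital_ge p en; rewrite size_path_to => h.
  apply: le_trans h _; apply: le_trans pE _.
  by rewrite (exprD _ _ B) ler_wpM2l// exprn_ge0.
have cN : 0 < (2 `^ (1 - s)) ^+ N :> R by rewrite exprn_gt0// powR_gt0.
rewrite -(ler_pM2l cN); apply: le_trans dE _; rewrite mulr1.
rewrite -powR_mulrn// -powR_mulrn ?powR_ge0// -powRrM.
rewrite leNgt ltr_powR2 -leNgt !natrD.
have n0 : 0 < n.+1%:R :> R by rewrite ltr0n.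
have NB' : L%:R + B%:R <= n.+1%:R^-1 * N%:R :> R by rewrite mulrC ler_pdivlMr// mulrC.
by apply: budget forcedE NB' _; rewrite ler_wpM2r// ltW.
Qed.

End Construction.

(** * Hardness *)

(* The label [h n] fixes the density [alpha + (1 - alpha) / (h n + 1)] of the
   free positions in the [n]-th block. *)
Lemma exists_labelled_points (R : realType) (alpha : R) :
  0 <= alpha -> alpha < 1 -> exists Y : (nat -> nat) -> cantor_space,
  [/\ forall n h h', (forall i, (i < n)%N -> h i = h' i) ->
        first_bits (Y h) n = first_bits (Y h') n,
      forall h, (forall k, exists N, forall n, (N <= n)%N -> (k <= h n)%N) ->
        Dim R (Y h) = alpha &
      forall h k, (forall N, exists2 n, (N <= n)%N & (h n <= k)%N) ->
        Dim R (Y h) <> alpha].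
Proof.
move=> a0 a1; have [E [gE EP]] := @enumerate_gales R.
pose beta k : R := alpha + (1 - alpha) * k.+1%:R^-1.
have b0 : 0 < 1 - alpha by rewrite subr_gt0.
have inv01 k : 0 < (k.+1%:R^-1 : R) <= 1.
  by rewrite invr_gt0 ltr0Sn invf_le1 ?ltr0Sn// ler1n.
have beta_gt k : alpha < beta k.
  by have /andP[k0 _] := inv01 k; rewrite ltrDl mulr_gt0.
have beta01 k : 0 <= beta k <= 1.
  rewrite (le_trans a0 (ltW (beta_gt k)))/= /beta.
  have /andP[_] := inv01 k; move: k.+1%:R^-1 => i i1.
  by have := ler_wpM2l (ltW b0) i1; lra.
have beta_anti m k : (m <= k)%N -> beta k <= beta m.
  move=> mk; rewrite lerD2l ler_wpM2l ?(ltW b0)// lef_pV2 ?posrE ?ltr0Sn//.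
  by rewrite ler_nat ltnS.
pose Y h := path_point ((beta \o h) \o block E) (capital E \o block E).
(* A gale witnessing [Dim < q] is some [E e]. In a block [n > e] with [q <= beta (h n)], late enough
   that [1 / (n + 1) < q - s], it ends at most 1, although it should exceed 1 from [N0] on. *)
have low h q : (forall N, exists2 n, (N <= n)%N & q <= beta (h n)) ->
    q <= Dim R (Y h).
  move=> io; rewrite leNgt.
  apply/negP => /Dim_ltP[s [d [/andP[s0 sq] gd ld [N0 N0d]]]].
  have [e Ee] : exists e, E e = (s, d).
    apply: (EP s d (first_bits (Y h) N0)) => //.
    by rewrite gt_eqF// (lt_trans ltr01)// N0d.
  have [m mlt] : exists m, forall n, (m <= n)%N -> n.+1%:R^-1 < q - s.
    by apply: exists_invr_lt; rewrite subr_gt0.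
  have [n] := io (maxn (maxn m N0) e.+1).
  rewrite !geq_max => /andP[/andP[mn N0n] en] qn.
  have := @path_defeats R E gE (beta \o h) e n en (beta01 _).
  rewrite Ee /= => /(_ _)/wrap[]; first by have := mlt n mn;
    move: n.+1%:R^-1 (beta (h n)) qn => i b qb ib; lra.
  apply/negP; rewrite -ltNge; apply: N0d.
  exact: leq_trans N0n (leq_trans (leqnSn n) (leq_boundary E n.+1)).
exists Y; split.
- move=> n h h' hh; rewrite !first_bits_path; apply: eq_path_to => j jn /=.
  by rewrite hh// (leq_ltn_trans (block_le E j)).
(* The lower bound is [low] at [alpha]. For the upper one, eventually every 1 of the point sits at a
   [beta k]-free position. *)
- move=> h hoo; apply/le_anti/andP; split; last first.
    by apply: low => N; exists N => //; exact: ltW.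
  apply/ler_addgt0Pr => e e0; have [k ke] := exists_invr_lt e0.
  have [N Nk] := hoo k.
  apply/ltW/(@Dim_lt_free R _ (beta k)).
  + exact: le_trans a0 (ltW (beta_gt k)).
  + have /andP[+ _] := inv01 k; have := ke k (leqnn k).
    rewrite /beta; move: k.+1%:R^-1 => i ie i0.
    by have := mulr_ge0 a0 (ltW i0); lra.
  + exists (boundary E N) => j Nj /path_point_free; apply: free_mono.
    exact/beta_anti/Nk/block_ge.
- move=> h k io Da; have := low h (beta k).
  rewrite Da leNgt beta_gt => /(_ _)/wrap[]//.
  by move=> N; have [n Nn /beta_anti] := io N; exists n.
Qed.

(** * Labels that tend to infinity exactly on a given Pi^0_3 set *)

Definition first_index (P : pred nat) n : nat := find P (iota 0 n).

Lemma first_index_le (P : pred nat) n : (first_index P n <= n)%N.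
Proof. by rewrite -[leqRHS](size_iota 0 n) find_size. Qed.

Lemma first_index_min (P : pred nat) n j : (j < n)%N -> P j -> (first_index P n <= j)%N.
Proof.
move=> jn Pj; rewrite leqNgt; apply/negP => ji.
by have := before_find 0%N ji; rewrite nth_iota// add0n Pj.
Qed.

Lemma first_indexP (P : pred nat) n : (first_index P n < n)%N -> P (first_index P n).
Proof.
move=> lt; have : has P (iota 0 n) by rewrite has_find size_iota.
by move=> /(nth_find 0%N); rewrite nth_iota.
Qed.

Lemma eq_first_index (P Q : pred nat) n : P =1 Q -> first_index P n = first_index Q n.
Proof. by move=> PQ; apply: eq_find. Qed.

Lemma nondecreasing_bounded_stationary (u : nat -> nat) B :
  (forall n, (u n <= u n.+1)%N) -> (forall n, (u n <= B)%N) ->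
  exists N, forall n, (N <= n)%N -> u n = u N.
Proof.
move=> uS uB.
have u_mono m n : (m <= n)%N -> (u m <= u n)%N.
  move=> mn; rewrite -(subnK mn); elim: (n - m)%N => // k IHk.
  exact: leq_trans IHk (uS _).
suff /(_ B 0%N (leq_subr _ _)) : forall k N, (B - u N <= k)%N ->
  exists N', forall n, (N' <= n)%N -> u n = u N' by [].
elim=> [|k IHk] N Bk.
  by exists N => n Nn; have := u_mono N n Nn; have := uB n; lia.
have [?|/existsNP[n /not_implyP[Nn /eqP un]]] :=
  pselect (forall n, (N <= n)%N -> u n = u N); first by exists N.
by apply: (IHk n); have := u_mono N n Nn; have := uB n; lia.
Qed.

Section Labels.
Variable G : nat -> nat -> set cantor_space.
Hypothesis oG : forall i j, open (~` G i j).
Implicit Types X Y : cantor_space.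

(* [guess X i n] is the first [j] for which the first [n] bits of [X] do not
   refute [X \in G i j]; row [i] acts when the guess changes. *)
Definition guess X i n : nat := first_index (fun j =>
  `[< exists2 Y, G i j Y & first_bits Y n = first_bits X n >]) n.

Definition acts X i n : bool := guess X i n != guess X i n.+1.

(** The least acting row, with default [n]: it tends to infinity iff every row acts finitely
    often. *)
Definition label X n : nat := first_index (acts X ^~ n) n.

Lemma guess_first_bits X Y i n : first_bits X n = first_bits Y n ->
  guess X i n = guess Y i n.
Proof. by move=> XY; apply: eq_first_index => j; rewrite XY. Qed.

Lemma label_first_bits X Y n : first_bits X n.+1 = first_bits Y n.+1 ->
  label X n = label Y n.
Proof.
move=> XY; apply: eq_first_index => i; rewrite /acts.
by rewrite (guess_first_bits _ XY) (guess_first_bits _ (first_bits_le _ XY)).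
Qed.

(** Refutations persist under longer prefixes. *)
Lemma guess_nondecreasing X i n : (guess X i n <= guess X i n.+1)%N.
Proof.
have [lt|] := ltnP (guess X i n.+1) n; last first.
  by apply: leq_trans; exact: first_index_le.
have /asboolP[Y GY YX] := first_indexP (ltnW lt : guess X i n.+1 < n.+1)%N.
apply: first_index_min => //; apply/asboolP; exists Y => //.
exact: first_bits_le YX.
Qed.

(** A true witness [j] is never refuted and bounds the guesses, which are nondecreasing. Conversely
    a final guess is never refuted, and [G i j] is closed. *)
Lemma guess_stationaryP X i : (\bigcup_j G i j) X <->
  exists N, forall n, (N <= n)%N -> ~~ acts X i n.
Proof.
split=> [[j _ GX]|[N noact]].
  have [|N Ng] := @nondecreasing_bounded_stationary (guess X i) j
    (guess_nondecreasing X i).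
    move=> n; have [jn|nj] := ltnP j n.
      by apply: first_index_min => //; apply/asboolP; exists X.
    exact: leq_trans (first_index_le _ _) nj.
  by exists N => n Nn; rewrite /acts negbK !Ng// (leq_trans Nn).
set j := guess X i N; have gE n : (N <= n)%N -> guess X i n = j.
  move=> Nn; rewrite -(subnK Nn); elim: (n - N)%N => // k IHk.
  by have /negPn/eqP := noact (k + N)%N (leq_addl _ _); rewrite IHk => <-.
exists j => //; apply: contrapT => nGX.
have /open_cantorP/(_ X nGX)[m mG] := oG i j.
(* Beyond [j], the guess [j] is a genuine index and not the default value. *)
pose n := maxn m (maxn N j.+1).
have [mn Nn jn] : [/\ (m <= n)%N, (N <= n)%N & (j < n)%N] by split; lia.
have : (guess X i n < n)%N by rewrite gE.
move=> /first_indexP; rewrite -/(guess X i n) gE// => /asboolP[Y GY YX].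
by apply: mG GY; exact: first_bits_le YX.
Qed.

Lemma label_unbounded X : (\bigcap_i \bigcup_j G i j) X ->
  forall k, exists N, forall n, (N <= n)%N -> (k <= label X n)%N.
Proof.
move=> GX k.
have [N NP] : exists N, forall i n, (i < k)%N -> (N <= n)%N -> ~~ acts X i n.
  elim: k => [|k [N IHk]]; first by exists 0%N.
  have /guess_stationaryP[N' N'P] := GX k I.
  exists (maxn N N') => i n; rewrite ltnS leq_eqVlt geq_max.
  by move=> /orP[/eqP -> /andP[_ /N'P]//|ik /andP[Nn _]]; exact: IHk.
exists (maxn N k) => n; rewrite geq_max => /andP[Nn kn]; rewrite leqNgt.
apply/negP => lk; have := first_indexP (leq_trans lk kn).
by apply/negP; exact: NP.
Qed.

Lemma label_bounded_infinitely_often X : ~ (\bigcap_i \bigcup_j G i j) X ->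
  exists k, forall N, exists2 n, (N <= n)%N & (label X n <= k)%N.
Proof.
move=> /existsNP[i /not_implyP[_ nGX]]; exists i => N.
have : ~ forall n, (maxn N i.+1 <= n)%N -> ~~ acts X i n.
  (* From [i.+1] on, row [i] is within the range searched by [label]. *)
  by move=> h; apply/nGX/guess_stationaryP; exists (maxn N i.+1).
move=> /existsNP[n /not_implyP[]]; rewrite geq_max => /andP[Nn ni].
by move=> /negP/negPn Xin; exists n => //; exact: first_index_min.
Qed.

End Labels.

(** * Completeness and its consequences *)

Lemma wadge_complete_DIM_str (R : realType) (alpha : R) :
  0 <= alpha -> alpha < 1 ->
  wadge_complete (@Pi0 cantor_space 3) (DIM_str alpha).
Proof.
move=> a0 a1; split; first exact: Pi03_DIM_str.
move=> A /Pi03P[G oG ->].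
have [Y [Ycont Yin Yout]] := exists_labelled_points a0 a1.
exists (fun X => Y (label G X)); split.
  apply: continuous_cantor => n X; exists n => Z ZX.
  apply: Ycont => i ltin; apply: label_first_bits.
  exact: first_bits_le ltin ZX.
move=> X; split=> [/(label_unbounded oG)/Yin//|DX].
apply: contrapT => /(label_bounded_infinitely_often oG)[k kP].
exact: Yout kP DX.
Qed.

(** The innermost quantifier ranges over prefixes and defines an open set; the outer two give a
    union of intersections. *)
Lemma Sigma03_Pi01_Sigma03 (X : set cantor_space) :
  Sigma03_Pi01 X -> Sigma0 3 X.
Proof.
move=> [P _ XP].
exists (fun k3 => [set A | forall k2, exists k1, P k3 k2 (first_bits A k1)]).
  move=> k3; exists (fun k2 => ~` [set A | exists k1, P k3 k2 (first_bits A k1)]).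
    move=> k2; rewrite /Sigma0 setCK; apply/open_cantorP => A [k1 PA].
    by exists k1 => B BA; exists k1; rewrite BA.
  by rewrite -setC_bigcap; congr (~` _); apply/seteqP; split=> A /= h k2;
    [move=> _|]; exact: h.
apply/seteqP; split=> A; first by move=> /XP[k3 Pk3]; exists k3.
by move=> [k3 _ Pk3]; apply/XP; exists k3.
Qed.

Theorem mainTheorem12 (R : realType) (alpha : R)
    (alpha_ge0 : 0 <= alpha) (alpha_lt1 : alpha < 1) :
  [/\ wadge_complete (@Pi0 cantor_space 3) (DIM_str alpha),
      ~ Sigma0 3 (DIM_str alpha)
    & ~ Sigma03_Pi01 (DIM_str alpha)].
Proof.
have complete := wadge_complete_DIM_str alpha_ge0 alpha_lt1.
have nSigma : ~ Sigma0 3 (DIM_str alpha).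
  (* Sigma^0_3 is closed under continuous preimages, so the reduction would put [D] in it. *)
  move=> S3; have [D /complete.2[f [cf fD]]] := exists_Pi03_not_Sigma03; apply.
  have -> : D = f @^-1` DIM_str alpha by apply/seteqP; split=> X /fD.
  exact: Sigma0_preimage.
by split=> // /Sigma03_Pi01_Sigma03.
Qed.
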